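(* Let $\delta\in(0,1/4)$. For every irreducible reversible Markov chain with transition matrix $P$ on a finite set $\mathcal{X}$ of size $d\ge2$, with stationary distribution $\pi$ and eigenvalues ordered by absolute value $1=|\lambda_{[1]}|\ge|\lambda_{[2]}|\ge\dots\ge|\lambda_{[d]}|\ge0$ with $\lambda_{[1]}=1$, there exist $\varepsilon\in(0,1)$ and two pairs of distinct initial distributions $\mu,\mu'$ and $\gamma,\gamma'$ on $\mathcal{X}$, with $\mu,\mu',\pi$ pairwise having $\varepsilon$-bounded likelihood-ratios and $\gamma,\gamma',\pi$ pairwise having $\varepsilon$-bounded likelihood-ratios, such that for all integers $t\ge0$ $$ \frac{n^*_{\mu,\mu',t}}{n^*_{\gamma,\gamma',t}}\ \asymp\ \frac{n^*_{\mu,\mu',0}}{n^*_{\gamma,\gamma',0}}\left(\frac{\lambda_{[2]}}{\lambda_{[d]}}\right)^{2t}, $$ where $n^*_{\mu,\mu',t}$ denotes the sample complexity of testing between $\mu$ and $\mu'$ from observations after $t$ steps of the chain.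
   Context: Conventions: $P_{xy}$ is the probability of moving from $x$ to $y$; distributions are row vectors; $\mu_t=\mu P^t$. Reversible means $\pi_xP_{xy}=\pi_yP_{yx}$ for all $x,y$; the eigenvalues of $P$ (with multiplicity) are then real and lie in $[-1,1]$. Two distributions $\mu,\mu'$ on $\mathcal{X}$ have an $\varepsilon$-bounded likelihood-ratio if $\varepsilon\le\mu_x/\mu'_x\le1/\varepsilon$ for all $x\in\mathcal{X}$. Testing problem: $X_1,\dots,X_n$ are i.i.d. from $\nu_t=\nu P^t$ with $\nu\in\{\mu,\mu'\}$ unknown. A test is a map $\psi:\mathcal{X}^n\to\{\mu,\mu'\}$, with maximum probability of error $\max\{\mathbf{P}_{\mu_t}^{\otimes n}(\psi\ne\mu),\mathbf{P}_{\mu'_t}^{\otimes n}(\psi\neq\mu')\}$. Sample complexity: $n^*_{\mu,\mu',t}\in[1,\infty]$ is the quantity, determined up to factors depending only on $\delta$ and $\varepsilon$, such that for some constants $c,C>0$ depending only on $\delta,\varepsilon$: for all integers $n\ge C\,n^*_{\mu,\mu',t}$ some test has maximum probability of error smaller than $\delta$, and for all integers $1\le n\le c\,n^*_{\mu,\mu',t}$ every test has maximum probability of error at least $1/2-\delta$. If $\mu_t=\mu'_t$ then $n^*_{\mu,\mu',t}=\infty$. $A\asymp B$ means $K^{-1}B\le A\le KB$ for some $K>0$ depending only on $\delta$ and $\varepsilon$ (in particular not on $t$, $d$ or $P$). Conventions: $z^0=1$ for every $z$ (including when $\lambda_{[d]}=0$), and $a/0=\infty$ for $a\neq 0$; if $\lambda_{[2]}\ne0=\lambda_{[d]}$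 and $t\ge1$, the assertion means that both sides equal $\infty$. If $\lambda_{[2]}=0$, the ratio is undefined for $t\ge1$ and nothing is asserted for those $t$. *)

(* Defs.v *)
(* MathComp / MathComp-Analysis *)
From mathcomp Require Import all_boot all_order all_algebra.
From mathcomp Require Import reals ereal.

Set Implicit Arguments.
Unset Strict Implicit.
Unset Printing Implicit Defensive.

Import Order.TTheory GRing.Theory Num.Theory.
Local Open Scope ring_scope.

(* The state space is 'I_d; distributions are row vectors and P x y is the
   probability of moving from x to y. *)

Definition is_distribution (R : realType) (d : nat) (mu : 'rV[R]_d) : Prop :=
  (forall x, 0 <= mu 0 x) /\ \sum_x mu 0 x = 1.

Definition is_stochastic (R : realType) (d : nat) (P : 'M[R]_d) : Prop :=
  forall x, is_distribution (row x P).

Definition is_irreducible (R : realType) (d : nat) (P : 'M[R]_d) : Prop :=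
  forall x y, exists k : nat, 0 < (P ^+ k) x y.

Definition is_stationary (R : realType) (d : nat) (P : 'M[R]_d)
    (pi : 'rV[R]_d) : Prop :=
  is_distribution pi /\ pi *m P = pi.

Definition is_reversible (R : realType) (d : nat) (P : 'M[R]_d)
    (pi : 'rV[R]_d) : Prop :=
  forall x y, pi 0 x * P x y = pi 0 y * P y x.

(* lam`_0, ..., lam`_(d.-1) are lambda_[1], ..., lambda_[d]: the eigenvalues
   with multiplicity (the characteristic polynomial splits as stated), sorted by
   nonincreasing absolute value.  Ties may be ordered arbitrarily, except that
   lambda_[1] is the eigenvalue 1. *)
Definition ordered_eigenvalues (R : realType) (d : nat) (P : 'M[R]_d)
    (lam : d.-tuple R) : Prop :=
  [/\ char_poly P = \prod_(a <- lam) ('X - a%:P),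
      forall i j : nat, (i <= j)%N -> (j < d)%N -> `|lam`_j| <= `|lam`_i| &
      lam`_0 = 1].

Definition after (R : realType) (d : nat) (P : 'M[R]_d) (t : nat)
    (mu : 'rV[R]_d) : 'rV[R]_d := mu *m P ^+ t.

(* Since x / 0 = 0, a vanishing denominator violates the lower bound. *)
Definition bounded_likelihood_ratio (R : realType) (d : nat) (eps : R)
    (mu mu' : 'rV[R]_d) : Prop :=
  forall x, eps <= mu 0 x / mu' 0 x <= 1 / eps.

Definition iid_prob (R : realType) (d n : nat) (nu : 'rV[R]_d)
    (A : pred (n.-tuple 'I_d)) : R :=
  \sum_(s : n.-tuple 'I_d | A s) \prod_(i < n) nu 0 (tnth s i).

(* A test is encoded by psi : n.-tuple 'I_d -> bool, where the value true stands
   for the decision mu and false for the decision mu'. *)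
Definition max_error (R : realType) (d n : nat) (P : 'M[R]_d)
    (mu mu' : 'rV[R]_d) (t : nat) (psi : n.-tuple 'I_d -> bool) : R :=
  Num.max (iid_prob (after P t mu) (fun s => ~~ psi s))
          (iid_prob (after P t mu') (fun s => psi s)).

(* N is a version, with constants c and C, of the sample complexity of testing
   between mu and mu' after t steps.  If mu P^t = mu' P^t then every test has
   maximum error at least 1/2, so that N = +oo is the only version. *)
Definition is_sample_complexity (R : realType) (d : nat) (delta c C : R)
    (P : 'M[R]_d) (mu mu' : 'rV[R]_d) (t : nat) (N : \bar R) : Prop :=
  [/\ (1 <= N)%E,
      forall n : nat, (C%:E * N <= n%:R%:E)%E ->
        exists psi : n.-tuple 'I_d -> bool, max_error P mu mu' t psi < delta &
      forall n : nat, (1 <= n)%N -> (n%:R%:E <= c%:E * N)%E ->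
        forall psi : n.-tuple 'I_d -> bool,
          1 / 2 - delta <= max_error P mu mu' t psi].

Definition comparable_up_to (R : realType) (K : R) (A B : \bar R) : Prop :=
  (K^-1%:E * B <= A)%E /\ (A <= K%:E * B)%E.

Definition admissible_pair (R : realType) (d : nat) (eps : R)
    (pi mu mu' : 'rV[R]_d) : Prop :=
  [/\ is_distribution mu /\ is_distribution mu', mu <> mu',
      bounded_likelihood_ratio eps mu mu',
      bounded_likelihood_ratio eps mu pi &
      bounded_likelihood_ratio eps mu' pi].

(* Main.v *)
Require Import Defs.
From mathcomp Require Import all_boot all_order all_algebra.
From mathcomp Require Import reals ereal.
From mathcomp Require Import ring lra.
Import Order.TTheory GRing.Theory Num.Theory.
Local Open Scope ring_scope.

(** The two pairs are [(pi + w, pi)] and [(pi + v, pi)], where [w] and [v] are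
    small left eigenvectors of [P], of total mass zero, for the eigenvalues of
    smallest absolute value and of second largest absolute value.  After [t]
    steps the first pair has become [(pi + lambda ^+ t *: w, pi)], so its
    chi-square divergence has been multiplied by exactly [lambda ^+ (2 * t)],
    and likewise for the second.  The rest is the fact that the sample
    complexity of testing between [p] and [q] has the order of the inverse of
    the chi-square divergence as long as [p] stays within [q / 2] of [q]
    entrywise, a condition that the chain preserves.

    The two halves of that fact ([every_test_errs], [some_test_succeeds]) only
    use that sums of products over samples factor.  For the lower bound,
    [1 + chi2] is multiplicative over independent samples and chi-square
    controls the gap between the probabilities of any event.  For the upper
    bound, the likelihood-ratio test errs with total probability
    [\sum_s min (p s) (q s)], at most the Bhattacharyya affinity
    [\sum_s sqrt (p s * q s)], which is multiplicative too and is at most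
    [1 - chi2 / 16] for one sample.

    The eigenvectors come from [sum_zero_eigenvector].  For an eigenvalue
    different from 1 the total mass vanishes automatically; for a second
    occurrence of the eigenvalue 1, one removes the first occurrence by
    passing to [P - e *m pi], with [e] the column of ones
    ([char_poly_deflation]).

    Taking [pi] as one element of each pair makes one value, [eps = 1 / 2],
    suit all chains, so that the constants depend on [delta], [c] and [C]
    alone. *)

Set Implicit Arguments.
Unset Strict Implicit.
Unset Printing Implicit Defensive.

(** * Chi-square divergence *)

Definition chi2 (R : realType) (T : finType) (p q : T -> R) : R :=
  \sum_x (p x - q x) ^+ 2 / q x.

Definition half_close (R : realType) (T : finType) (p q : T -> R) : Prop :=
  forall x, `|p x - q x| <= q x / 2.

Lemma sum_tuple_prod (R : comNzRingType) (T : finType) (n : nat) (f : T -> R) :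
  \sum_(s : n.-tuple T) \prod_(i < n) f (tnth s i) = (\sum_x f x) ^+ n.
Proof.
rewrite -[n in RHS]card_ord -prodr_const bigA_distr_bigA /=.
rewrite (reindex (fun g : {ffun 'I_n -> T} => [tuple g i | i < n])) /=.
  by apply: eq_bigr => g _; apply: eq_bigr => i _; rewrite tnth_mktuple.
exists (fun s : n.-tuple T => [ffun i => tnth s i]) => [g _|s _].
  by apply/ffunP=> i; rewrite ffunE tnth_mktuple.
by apply: eq_from_tnth => i; rewrite tnth_mktuple ffunE.
Qed.

Lemma chi2_ge0 (R : realType) (T : finType) (p q : T -> R) :
  (forall x, 0 < q x) -> 0 <= chi2 p q.
Proof.
by move=> q0; apply: sumr_ge0 => x _; rewrite divr_ge0 ?sqr_ge0 // ltW.
Qed.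

(** The left-hand side, unlike [chi2] itself, is multiplicative over independent
    samples. *)
Lemma chi2E (R : realType) (T : finType) (p q : T -> R) :
  (forall x, 0 < q x) -> \sum_x p x = 1 -> \sum_x q x = 1 ->
  \sum_x p x ^+ 2 / q x = 1 + chi2 p q.
Proof.
move=> q0 p1 q1; rewrite -[X in X + _](_ : \sum_x (2 * p x - q x) = 1).
  rewrite /chi2 -big_split /=; apply: eq_bigr => x _.
  by field; rewrite gt_eqF.
by rewrite sumrB -mulr_sumr p1 q1 mulr1 -(natrB _ (isT : 1 <= 2)%N).
Qed.

(** The gap is the expectation under [q] of the density [p / q - 1] over [A], so
    the Cauchy-Schwarz inequality applies. *)
Lemma sqr_event_gap_le_chi2 (R : realType) (T : finType) (p q : T -> R)
    (A : pred T) :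
  (forall x, 0 < q x) -> \sum_x q x = 1 ->
  (\sum_(x | A x) p x - \sum_(x | A x) q x) ^+ 2 <= chi2 p q.
Proof.
move=> q0 q1; rewrite -sumrB; set m := \sum_(x | A x) _.
have mE : m = \sum_x (A x)%:R * (p x - q x).
  rewrite /m big_mkcond; apply: eq_bigr => x _.
  by case: (A x); rewrite ?mul1r ?mul0r.
(* Expanding this square gives Cauchy-Schwarz: m is the optimal multiplier up
   to the factor q(A) <= 1. *)
have: 0 <= \sum_x ((p x - q x) - m * (A x)%:R * q x) ^+ 2 / q x.
  by apply: sumr_ge0 => x _; rewrite divr_ge0 ?sqr_ge0 // ltW.
suff -> : \sum_x ((p x - q x) - m * (A x)%:R * q x) ^+ 2 / q x =
    chi2 p q - 2 * m * m + m ^+ 2 * \sum_x (A x)%:R * q x.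
  have : \sum_x (A x)%:R * q x <= 1.
    rewrite -[leRHS]q1; apply: ler_sum => x _.
    by case: (A x); rewrite ?mul1r ?mul0r ?lexx ?ltW.
  by move=> /(ler_wpM2l (sqr_ge0 m)); lra.
move: m mE => m mE; rewrite {3}mE /chi2 !mulr_sumr -sumrB -big_split /=.
apply: eq_bigr => x _.
by case: (A x) => /=; field; rewrite gt_eqF.
Qed.

(** Together with [expr1B_le], this replaces exponential estimates of
    [(1 + D) ^+ n] and [(1 - x) ^+ n] by elementary ones, which suffice because
    constants do not matter. *)
Lemma exprD1_le (R : realType) (D : R) (n : nat) :
  0 <= D -> n%:R * D <= 1 / 2 -> (1 + D) ^+ n <= 1 + 2 * (n%:R * D).
Proof.
move=> D0; elim: n => [|n IHn]; first by rewrite expr0 mul0r mulr0 addr0.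
rewrite -natr1 mulrDl mul1r => h.
have nD0 : 0 <= n%:R * D by rewrite mulr_ge0.
have /IHn {}IHn : n%:R * D <= 1 / 2 by lra.
rewrite exprS; have := ler_wpM2l (_ : 0 <= 1 + D) IHn.
by move/(_ (addr_ge0 ler01 D0)); move: (n%:R * D) h nD0 => z; nra.
Qed.

Lemma expr1B_le (R : realType) (x : R) (n : nat) :
  0 <= x <= 1 -> (1 - x) ^+ n * (1 + n%:R * x) <= 1.
Proof.
move=> /andP[x0 x1]; elim: n => [|n IHn].
  by rewrite expr0 mul0r addr0 mul1r.
apply: le_trans IHn; rewrite exprSr -mulrA ler_wpM2l ?exprn_ge0 ?subr_ge0 //.
rewrite -natr1; have : 0 <= n%:R :> R by [].
by move: (n%:R) => z z0; have := sqr_ge0 x; nra.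
Qed.

(** * Error probabilities of tests between product distributions *)

Definition iid (R : realType) (T : finType) (n : nat) (p : T -> R)
    (s : n.-tuple T) : R := \prod_(i < n) p (tnth s i).
Arguments iid {R T} n p s.

Lemma chi2_iid (R : realType) (T : finType) (n : nat) (p q : T -> R) :
  (forall x, 0 < q x) -> \sum_x p x = 1 -> \sum_x q x = 1 ->
  1 + chi2 (iid n p) (iid n q) = (1 + chi2 p q) ^+ n.
Proof.
move=> q0 p1 q1; rewrite -chi2E ?sum_tuple_prod ?p1 ?q1 ?expr1n //.
  rewrite -chi2E // -sum_tuple_prod; apply: eq_bigr => s _.
  by rewrite prodf_div prodrXl.
by move=> s; apply: prodr_gt0.
Qed.

(** The sum of the two errors is one minus the gap between the probabilities of
    the event [psi], and the squared gap is at most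
    [(1 + chi2 p q) ^+ n - 1 <= 2 * n * chi2 p q]. *)
Lemma every_test_errs (R : realType) (T : finType) (n : nat) (delta : R)
    (p q : T -> R) (psi : n.-tuple T -> bool) :
  (forall x, 0 < q x) -> \sum_x p x = 1 -> \sum_x q x = 1 ->
  0 < delta < 1 / 4 -> n%:R * chi2 p q <= 2 * delta ^+ 2 ->
  1 / 2 - delta <= Num.max (\sum_(s | ~~ psi s) iid n p s)
                           (\sum_(s | psi s) iid n q s).
Proof.
move=> q0 p1 q1 /andP[d0 d1] nD.
have iidq0 s : 0 < iid n q s by apply: prodr_gt0.
have iidq1 : \sum_s iid n q s = 1 by rewrite sum_tuple_prod q1 expr1n.
have iidp1 : \sum_s iid n p s = 1 by rewrite sum_tuple_prod p1 expr1n.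
have := sqr_event_gap_le_chi2 (iid n p) psi iidq0 iidq1.
have := chi2_iid n q0 p1 q1.
have := exprD1_le (n := n) (chi2_ge0 p q0).
have h : n%:R * chi2 p q <= 1 / 2 by apply: le_trans nD _; nra.
move=> /(_ h) le1 eq2 le3.
have : (\sum_(s | psi s) iid n p s - \sum_(s | psi s) iid n q s) ^+ 2 <=
    (2 * delta) ^+ 2 by lra.
rewrite -ler_sqrt ?sqr_ge0 // !sqrtr_sqr.
rewrite (gtr0_norm (_ : 0 < 2 * delta)) ?mulr_gt0 // => /ler_normlP[_].
move: iidp1; rewrite (bigID psi) /=.
set u := \sum_(s | psi s) iid n p s; set v := \sum_(s | ~~ _) _.
set w := \sum_(s | psi s) iid n q s => uv uw; rewrite le_max.
case: (leP (1 / 2 - delta) v) => //= hv; lra.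
Qed.

(** With [g = p / q - 1], this is the second-order bound
    [sqrt (1 + g) <= 1 + g / 2 - g ^+ 2 / 16] for [`|g| <= 1 / 2]. *)
Lemma sqrt_affinity_le (R : realType) (p q : R) :
  0 < q -> `|p - q| <= q / 2 ->
  Num.sqrt (p * q) <= q + (p - q) / 2 - (p - q) ^+ 2 / q / 16.
Proof.
move=> q0 hpq; pose g := (p - q) / q.
have pE : p = q * (1 + g) by rewrite /g; field; rewrite gt_eqF.
have /andP[g1 g2] : - (1 / 2) <= g <= 1 / 2.
  move: hpq; rewrite ler_norml => /andP[? ?].
  by rewrite ler_pdivlMr // ler_pdivrMr //; apply/andP; split; lra.
have -> : q + (p - q) / 2 - (p - q) ^+ 2 / q / 16 =
    q * (1 + g / 2 - g ^+ 2 / 16).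
  by rewrite /g; field; rewrite gt_eqF.
have r0 : 0 <= 1 + g / 2 - g ^+ 2 / 16 by nra.
rewrite -[leRHS]ger0_norm ?mulr_ge0 ?(ltW q0) // -sqrtr_sqr ler_wsqrtr //.
have -> : p * q = q ^+ 2 * (1 + g) by rewrite pE; ring.
rewrite exprMn ler_wpM2l ?sqr_ge0 // -subr_ge0.
have -> : (1 + g / 2 - g ^+ 2 / 16) ^+ 2 - (1 + g) =
  g ^+ 2 * (1 / 8 - g / 16 + g ^+ 2 / 256) by field.
by rewrite mulr_ge0 ?sqr_ge0 //; have := sqr_ge0 g; lra.
Qed.

Lemma chi2_half_close (R : realType) (T : finType) (p q : T -> R) :
  (forall x, 0 < q x) -> \sum_x q x = 1 -> half_close p q ->
  chi2 p q <= 1 / 4.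
Proof.
move=> q0 q1 pq.
rewrite -[leRHS](_ : \sum_x 1 / 4 * q x = _); last first.
  by rewrite -mulr_sumr q1 mulr1.
apply: ler_sum => x _; rewrite ler_pdivrMr //.
have := pq x; rewrite ler_norml => /andP[h1 h2].
have := mulr_ge0 (_ : 0 <= q x / 2 - (p x - q x))
  (_ : 0 <= p x - q x + q x / 2).
by rewrite !subr_ge0; nra.
Qed.

(** In the sum over [x] the linear term of [sqrt_affinity_le] cancels and the
    quadratic term gives the divergence. *)
Lemma affinity_le (R : realType) (T : finType) (p q : T -> R) :
  (forall x, 0 < q x) -> \sum_x p x = 1 -> \sum_x q x = 1 -> half_close p q ->
  \sum_x Num.sqrt (p x * q x) <= 1 - chi2 p q / 16.
Proof.
move=> q0 p1 q1 pq.
apply: (@le_trans _ _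
  (\sum_x (q x + (p x - q x) / 2 - (p x - q x) ^+ 2 / q x / 16))).
  by apply: ler_sum => x _; apply: sqrt_affinity_le.
by rewrite sumrB big_split /= -!mulr_suml sumrB p1 q1 subrr mul0r addr0.
Qed.

(** The likelihood-ratio test works: each outcome contributes the smaller of its
    two probabilities to the errors, hence at most their geometric mean. *)
Lemma some_test_succeeds (R : realType) (T : finType) (n : nat) (delta : R)
    (p q : T -> R) :
  (forall x, 0 < q x) -> \sum_x p x = 1 -> \sum_x q x = 1 -> half_close p q ->
  0 < delta -> 16 / delta <= n%:R * chi2 p q ->
  exists psi : n.-tuple T -> bool,
    Num.max (\sum_(s | ~~ psi s) iid n p s) (\sum_(s | psi s) iid n q s)
      < delta.
Proof.
move=> q0 p1 q1 pq d0 nD; pose psi s := iid n q s <= iid n p s.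
have p0 x : 0 <= p x.
  by have := pq x; have := q0 x; rewrite ler_norml => ? /andP[? ?]; lra.
have iidp0 s : 0 <= iid n p s by apply: prodr_ge0.
have iidq0 s : 0 <= iid n q s by apply: prodr_ge0 => i _; rewrite ltW.
exists psi.
have D0 := chi2_ge0 p q0; have D1 := chi2_half_close q0 q1 pq.
set e1 := \sum_(s | ~~ psi s) _; set e2 := \sum_(s | psi s) _.
have e10 : 0 <= e1 by apply: sumr_ge0.
have e20 : 0 <= e2 by apply: sumr_ge0.
have e12 : e1 + e2 <= (\sum_x Num.sqrt (p x * q x)) ^+ n.
  rewrite -sum_tuple_prod (bigID psi) /= addrC.
  have sqE s : \prod_(i < n) Num.sqrt (p (tnth s i) * q (tnth s i)) =
      Num.sqrt (iid n p s * iid n q s).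
    have ge0 : 0 <= \prod_(i < n) Num.sqrt (p (tnth s i) * q (tnth s i)).
      by apply: prodr_ge0 => i _; exact: sqrtr_ge0.
    rewrite -[LHS]ger0_norm //.
    rewrite -sqrtr_sqr -prodrXl -big_split /=; congr Num.sqrt.
    by apply: eq_bigr => i _; rewrite sqr_sqrtr ?mulr_ge0 // ltW.
  have minE (a b : R) : 0 <= a -> a <= b -> a <= Num.sqrt (a * b).
    move=> a0 ab; rewrite -[leLHS]ger0_norm // -sqrtr_sqr ler_wsqrtr //.
    by rewrite expr2 ler_wpM2l.
  apply: lerD; apply: ler_sum => s; rewrite sqE.
    by rewrite -ltNge => /ltW; apply: minE.
  by rewrite mulrC; apply: minE.
have rho0 : 0 <= \sum_x Num.sqrt (p x * q x).
  by apply: sumr_ge0 => x _; exact: sqrtr_ge0.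
have {e12} : e1 + e2 <= (1 - chi2 p q / 16) ^+ n.
  by apply: le_trans e12 _; rewrite lerXn2r ?nnegrE ?affinity_le //; lra.
have := @expr1B_le _ (chi2 p q / 16) n.
have -> : 0 <= chi2 p q / 16 <= 1 by lra.
move=> /(_ isT).
move: ((1 - chi2 p q / 16) ^+ n) => E hE eE.
have lt_sum : e1 + e2 < delta.
  have E0 : 0 <= E by lra.
  have h : delta^-1 <= n%:R * (chi2 p q / 16) by lra.
  have : E * (1 + delta^-1) <= 1.
    by apply: le_trans hE; rewrite ler_wpM2l // lerD2l.
  have di : delta^-1 * delta = 1 by rewrite mulVf ?gt_eqF.
  move=> hE2; apply: le_lt_trans eE _; rewrite ltNge; apply/negP => dE.
  have : delta * (1 + delta^-1) <= E * (1 + delta^-1).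
    by rewrite ler_wpM2r // addr_ge0 // invr_ge0 ltW.
  by lra.
by rewrite gt_max; apply/andP; split; lra.
Qed.

(** * Eigenvectors of total mass zero *)

(** Removing a right eigenvector [e] of eigenvalue 1 moves that eigenvalue to 0.
    Both sides come from the determinant of the bordered matrix with block rows
    [(1, - u)] and [(e, 'X - P)].  Column operations with the pivot 1 leave the
    characteristic matrix of [P - e *m u].  On the other hand, multiplying the
    first column by ['X - 1] and subtracting the combination of the others with
    coefficients [e] gives the column [('X, 0)]. *)
Lemma char_poly_deflation (R : comNzRingType) (n : nat) (P : 'M[R]_n)
    (u : 'rV[R]_n) (e : 'cV[R]_n) :
  P *m e = e -> u *m e = 1%:M ->
  char_poly (P - e *m u) * ('X - 1) = 'X * char_poly P.
Proof.
move=> Pe ue.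
pose eX := map_mx polyC e; pose uX := map_mx polyC u.
pose M : 'M_(1 + n) := block_mx 1%:M (- uX) eX (char_poly_mx P).
have PeX : char_poly_mx P *m eX = ('X - 1) *: eX.
  rewrite mulmxBl mul_scalar_mx -map_mxM Pe scalerBl scale1r //.
have MP : M = block_mx 1%:M 0 eX (char_poly_mx (P - e *m u)) *m
    block_mx 1%:M (- uX) 0 1%:M.
  rewrite mulmx_block !mul1mx !mul0mx !mulmx0 !mulmx1 !addr0; congr block_mx.
  rewrite /char_poly_mx map_mxB map_mxM mulmxN opprB addrA addrAC.
  by rewrite addrA addNr add0r addrC.
have MD : M *m block_mx ('X - 1)%:M 0 (- eX) 1%:M =
    block_mx 'X%:M (- uX) 0 (char_poly_mx P).
  rewrite mulmx_block !mulmx1 !mulmx0 !add0r mul1mx mulNmx mulmxN opprK.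
  rewrite -map_mxM ue map_mx1 -raddfD /= subrK.
  by rewrite mulmxN PeX mul_mx_scalar subrr.
have := congr1 determinant MD.
rewrite det_mulmx MP det_mulmx !det_ublock !det_lblock !det1 !det_scalar1.
by rewrite !mul1r !mulr1.
Qed.

(** Multiplying [v *m P = a *: v] by [e] gives [v *m e = a *: (v *m e)], which
    settles the case where [a] differs from 1.  If [a] is 1, it is still a root
    of the characteristic polynomial of [P - e *m u]; as this matrix kills [e],
    its eigenvectors for 1 do too. *)
Lemma sum_zero_eigenvector (F : fieldType) (n : nat) (P : 'M[F]_n)
    (u : 'rV[F]_n) (e : 'cV[F]_n) (lam : seq F) (a : F) :
  P *m e = e -> u *m e = 1%:M ->
  char_poly P = \prod_(b <- 1 :: lam) ('X - b%:P) -> a \in lam ->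
  exists v : 'rV[F]_n, [/\ v != 0, v *m P = a *: v & v *m e = 0].
Proof.
move=> Pe ue cP alam; case: (eqVneq a 1) => [a1|a1].
  have cD : char_poly (P - e *m u) = 'X * \prod_(b <- lam) ('X - b%:P).
    apply: (mulIf (negbT (polyXsubC_eq0 1))).
    rewrite polyC1 char_poly_deflation // cP big_cons; ring.
  have /eigenvalueP[v vP v0] : eigenvalue (P - e *m u) a.
    by rewrite eigenvalue_root_char cD rootM root_prod_XsubC alam orbT.
  have ve : v *m e = 0.
    have := congr1 (mulmx^~ e) vP; rewrite -mulmxA mulmxBl Pe -mulmxA ue mulmx1.
    by rewrite subrr mulmx0 a1 scale1r.
  exists v; split => //.
  by move: vP; rewrite mulmxBr mulmxA ve mul0mx subr0.
have /eigenvalueP[v vP v0] : eigenvalue P a.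
  by rewrite eigenvalue_root_char cP root_prod_XsubC inE alam orbT.
exists v; split => //; apply/eqP.
have := congr1 (mulmx^~ e) vP; rewrite -mulmxA Pe -scalemxAl => /eqP.
rewrite -subr_eq0 -{1}[v *m e]scale1r -scalerBl scaler_eq0 subr_eq0 eq_sym.
by rewrite (negPf a1).
Qed.

(** * Sample complexity and divergence *)

(** The sample complexity is of order [1 / D], with explicit constants.  The
    bound on [D] keeps [1 / D] away from 0, so that neither the constraint
    [1 <= N] nor the rounding of sample sizes to integers costs more than a
    constant factor. *)
Definition testable_at_rate (R : realType) (d : nat) (delta : R) (P : 'M[R]_d)
    (mu mu' : 'rV[R]_d) (t : nat) (D : R) : Prop :=
  [/\ 0 <= D <= 1 / 4,
      forall n, 16 / delta <= n%:R * D ->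
        exists psi : n.-tuple 'I_d -> bool, max_error P mu mu' t psi < delta &
      forall n, n%:R * D <= 2 * delta ^+ 2 ->
        forall psi : n.-tuple 'I_d -> bool,
          1 / 2 - delta <= max_error P mu mu' t psi].

Lemma sample_complexity_exists (R : realType) (d : nat) (delta : R)
    (P : 'M[R]_d) (mu mu' : 'rV[R]_d) (t : nat) (D : R) :
  0 < delta -> testable_at_rate delta P mu mu' t D ->
  is_sample_complexity delta (2 * delta ^+ 2) (16 / delta) P mu mu' t
    (D%:E)^-1%E.
Proof.
move=> d0 [/andP[D0 D1] easy hard].
have [DE|Dn0] := eqVneq D 0.
  rewrite DE inve0; split=> [|n|n _ _]; first exact: leey.
    by rewrite gt0_muley ?lte_fin ?divr_gt0 // leye_eq.
  by apply: hard; rewrite DE mulr0 mulr_ge0 ?sqr_ge0.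
have Dp : 0 < D by rewrite lt_def Dn0.
rewrite inver (negPf Dn0); split=> [|n|n _]; rewrite -?EFinM lee_fin.
- by rewrite -[1]invr1 lef_pV2 ?posrE //; lra.
- by rewrite ler_pdivrMr // => /easy.
- by rewrite ler_pdivlMr // => /hard.
Qed.

Definition has_order (R : realType) (k1 k2 D : R) (N : \bar R) : Prop :=
  (D = 0 -> N = +oo%E) /\
  (0 < D -> exists2 r : R, N = r%:E & k1 <= r * D <= k2).

(** A sample size cannot lie in both regimes, since [delta < 1 / 2 - delta].
    Applying this just above [C * N] bounds [N] from below, and just below
    [c * N] from above. *)
Lemma sample_complexity_has_order (R : realType) (d : nat) (delta c C : R)
    (P : 'M[R]_d) (mu mu' : 'rV[R]_d) (t : nat) (D : R) (N : \bar R) :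
  0 < delta < 1 / 4 -> 0 < c -> 0 < C ->
  testable_at_rate delta P mu mu' t D ->
  is_sample_complexity delta c C P mu mu' t N ->
  has_order (2 * delta ^+ 2 / (C + 1)) (32 / (delta * c)) D N.
Proof.
move=> /andP[d0 d1] c0 C0 [/andP[D0 D1] easy hard] [N1 Neasy Nhard].
have not_both n :
    (exists psi : n.-tuple 'I_d -> bool, max_error P mu mu' t psi < delta) ->
    ~ (forall psi : n.-tuple 'I_d -> bool,
         1 / 2 - delta <= max_error P mu mu' t psi).
  by move=> [psi h1] /(_ psi) h2; have := le_lt_trans h2 h1; lra.
have dd0 : 0 < 2 * delta ^+ 2 by rewrite mulr_gt0 ?exprn_gt0.
have dV : 64 < 16 / delta by rewrite ltr_pdivlMr //; lra.
have finite_above (r : R) : N = r%:E -> exists2 n, (0 < n)%N &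
    C * r < n%:R <= (C + 1) * r /\ 2 * delta ^+ 2 < n%:R * D.
  move=> NE; move: N1; rewrite NE lee_fin => r1.
  have Cr : 0 <= C * r by rewrite mulr_ge0 ?ltW //; lra.
  have /andP[fl1 fl2] := truncn_itv Cr.
  exists (Num.truncn (C * r)).+1 => //; split.
    by rewrite fl2 -natr1; lra.
  rewrite ltNge; apply/negP => /hard; apply: not_both; apply: Neasy.
  by rewrite NE -EFinM lee_fin ltW.
split=> [DE|Dp].
  (* A finite N would give a successful test although the pair is
     indistinguishable. *)
  case: N N1 Neasy Nhard finite_above => [r| |] // N1 _ _ /(_ r erefl)[n _ [_]].
  by rewrite DE mulr0 => /(lt_trans dd0); rewrite ltxx.
case: N N1 Neasy Nhard finite_above => [r| |] //; last first.
  move=> _ _ Nhard _; exfalso.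
  pose m := (Num.truncn (16 / delta / D)).+1.
  have m1 : 16 / delta <= m%:R * D.
    rewrite -ler_pdivrMr // ltW //.
    have /truncn_itv/andP[_ //] : 0 <= 16 / delta / D.
    by rewrite !divr_ge0 // ltW.
  apply: (not_both m (easy m m1)); apply: Nhard => //.
  by rewrite gt0_muley ?lte_fin // leey.
move=> N1 _ Nhard /(_ r erefl)[n n0 [/andP[nC1 nC2] nD]].
exists r => //; apply/andP; split.
  rewrite ler_pdivrMr; last lra.
  apply: ltW; apply: lt_le_trans nD _.
  by have := ler_wpM2r D0 nC2; lra.
have r1 : 1 <= r by [].
have -> : 32 / (delta * c) = (2 * (16 / delta)) / c.
  by field; rewrite !gt_eqF.
rewrite ler_pdivlMr //.
(* For c * r < 1 the lower bound on errors says nothing, but r is bounded. *)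
have [cr|cr] := ltP (c * r) 1.
  have : c * r * D <= 1 * D by rewrite ler_wpM2r // ltW.
  by rewrite mul1r; lra.
have cr0 : 0 <= c * r by lra.
have /andP[fl1 fl2] := truncn_itv cr0.
set m := Num.truncn (c * r) in fl1 fl2.
have m0 : (1 <= m)%N by rewrite truncn_ge_nat.
have mD : m%:R * D < 16 / delta.
  rewrite ltNge; apply/negP => /easy /not_both; apply; exact: Nhard.
have m1 : 1 <= m%:R :> R by rewrite ler1n.
have : c * r <= 2 * m%:R by move: fl2; rewrite -natr1; lra.
by move=> /(ler_wpM2r D0); lra.
Qed.

(** The power of the eigenvalue ratio when the smallest eigenvalue is 0 and a
    step has been made; the even exponent removes the sign of [a]. *)
Lemma even_expe_infty (R : realType) (a : R) (t : nat) :
  a != 0 -> (((a%:E * +oo) ^+ (2 * t.+1)%N) = +oo :> \bar R)%E.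
Proof.
move=> a0; set u := (_ * _)%E.
have uu : (u * u = +oo)%E.
  rewrite /u; case: (ltgtP a 0) a0 => // ha _.
    by rewrite lt0_muley ?lte_fin // mulNyNy.
  by rewrite gt0_muley ?lte_fin // mulyy.
elim: t => [|t IHt]; first by rewrite muln1 expe2.
by rewrite mulnS 2!expeS muleA uu IHt mulyy.
Qed.

(** Each of the two quotients of sample complexities is within a factor
    [k2 / k1] of the inverse quotient of divergences, and the quotients of
    divergences at the two times differ exactly by the even power of the
    eigenvalue ratio. *)
Lemma ratio_comparable (R : realType) (k1 k2 Dm Dg lm lg : R) (t : nat)
    (Nm0 Ng0 Nmt Ngt : \bar R) :
  0 < k1 -> 0 < k2 -> 0 < Dm -> 0 < Dg -> t = 0%N \/ lg <> 0 ->
  has_order k1 k2 Dm Nm0 -> has_order k1 k2 Dg Ng0 ->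
  has_order k1 k2 (lm ^+ (2 * t) * Dm) Nmt ->
  has_order k1 k2 (lg ^+ (2 * t) * Dg) Ngt ->
  comparable_up_to ((k2 / k1) ^+ 2) (Nmt / Ngt)%E
    ((Nm0 / Ng0) * ((lg%:E / lm%:E) ^+ (2 * t)%N))%E.
Proof.
move=> k10 k20 Dm0 Dg0 tlg [_ /(_ Dm0)[x3 -> y3]] [_ /(_ Dg0)[x4 -> y4]].
move=> [Nmty Nmtf] [_ Ngtf].
have K0 : 0 < (k2 / k1) ^+ 2 by rewrite exprn_gt0 ?divr_gt0.
have pos D x : 0 < D -> k1 <= x * D <= k2 -> 0 < x.
  move=> D0 /andP[h _]; rewrite -(pmulr_lgt0 _ D0); exact: lt_le_trans h.
have lgt0 : 0 < lg ^+ (2 * t).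
  rewrite exprM; case: tlg => [->|lg0]; first by rewrite expr0.
  by rewrite exprn_gt0 // lt_def sqrf_eq0 sqr_ge0 andbT; apply/eqP.
have Dgt0 : 0 < lg ^+ (2 * t) * Dg by rewrite mulr_gt0.
have [x2 -> y2] := Ngtf Dgt0.
have x20 := pos _ _ Dgt0 y2; have x30 := pos _ _ Dm0 y3.
have x40 := pos _ _ Dg0 y4.
rewrite !inver (gt_eqF x20) (gt_eqF x40) -EFinM.
(* If the first divergence has vanished, both sides are infinite. *)
have [/eqP lmt0|lmtn0] := boolP (lm ^+ (2 * t) == 0).
  have : 0 < x3 / x4 by rewrite divr_gt0.
  rewrite Nmty ?lmt0 ?mul0r // gt0_mulye ?lte_fin ?invr_gt0 // => x340.
  move: lmt0 => /eqP; rewrite expf_eq0 => /andP[t0 /eqP ->]; rewrite eqxx.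
  case: t t0 tlg {Nmty Nmtf Ngtf lgt0 Dgt0 y2} => // t _ [//|/eqP lg0].
  rewrite even_expe_infty // /comparable_up_to.
  by rewrite !gt0_muley ?lte_fin ?invr_gt0 // leey.
have lmt0 : 0 < lm ^+ (2 * t).
  by rewrite lt_def lmtn0 exprM exprn_ge0 ?sqr_ge0.
have Dmt0 : 0 < lm ^+ (2 * t) * Dm by rewrite mulr_gt0.
have [x1 -> y1] := Nmtf Dmt0; have x10 := pos _ _ Dmt0 y1.
have -> : ((lg%:E * (if lm == 0%R then +oo else (lm^-1)%R%:E)) ^+ (2 * t)%N =
           (lg ^+ (2 * t) / lm ^+ (2 * t))%R%:E)%E.
  have [lm0|lm0] := eqVneq lm 0; last by rewrite -EFinM -EFin_expe expr_div_n.
  case: t lmtn0 {tlg lgt0 Dgt0 y2 Nmty Nmtf Ngtf lmt0 Dmt0 y1} => [_|t].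
    by rewrite muln0 expe0 !expr0 divr1.
  by rewrite lm0 expr0n eqxx.
rewrite -!EFinM /comparable_up_to -!EFinM !lee_fin.
move: (lg ^+ _) (lm ^+ _) lgt0 lmt0 Dgt0 Dmt0 y1 y2.
move=> G M G0 M0 Dgt0 Dmt0 y1 y2.
have quot D D' x x' : 0 < D -> 0 < D' -> 0 < x' -> k1 <= x * D <= k2 ->
    k1 <= x' * D' <= k2 ->
    k1 / k2 * (D' / D) <= x / x' <= k2 / k1 * (D' / D).
  move=> D0 D'0 x'0 /andP[h1 h2] /andP[h3 h4].
  have -> : x / x' = ((x * D) / (x' * D')) * (D' / D).
    by field; rewrite !gt_eqF.
  have xD0 : 0 < x * D by apply: lt_le_trans h1.
  have x'D'0 : 0 < x' * D' by apply: lt_le_trans h3.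
  apply/andP.
  split; apply: ler_wpM2r; rewrite ?divr_ge0 ?(ltW D0) ?(ltW D'0) //.
    by apply: ler_pM; rewrite ?invr_ge0 ?lef_pV2 ?posrE ?(ltW k10) ?(ltW k20).
  by apply: ler_pM; rewrite ?invr_ge0 ?lef_pV2 ?posrE ?(ltW xD0) ?(ltW x'D'0).
have /andP[a1 a2] := quot _ _ _ _ Dmt0 Dgt0 x20 y1 y2.
have /andP[b1 b2] := quot _ _ _ _ Dm0 Dg0 x40 y3 y4.
have GM0 : 0 < G / M by rewrite divr_gt0.
move: a1 a2 (ler_wpM2r (ltW GM0) b1) (ler_wpM2r (ltW GM0) b2).
have ZE : G * Dg / (M * Dm) = Dg / Dm * (G / M) by field; rewrite !gt_eqF.
rewrite ZE -!(mulrA _ (Dg / Dm)).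
move: (Dg / Dm * (G / M)) (x3 / x4 * (G / M)) (x1 / x2) => Z X Y.
have kV : k1 / k2 = (k2 / k1)^-1 by rewrite invf_div.
rewrite kV; have : 0 < k2 / k1 by rewrite divr_gt0.
move: (k2 / k1) => k kp ZY YZ ZX XZ.
have kVp : 0 <= k^-1 by rewrite invr_ge0 ltW.
split.
  apply: le_trans ZY; rewrite expr2 invfM -mulrA ler_wpM2l //.
  by rewrite ler_pdivrMl.
apply: le_trans YZ _; rewrite expr2 -mulrA ler_wpM2l ?(ltW kp) //.
by rewrite -ler_pdivrMl.
Qed.

(** * Perturbing the stationary distribution along an eigenvector *)

Lemma stochastic_expr_ge0 (R : realType) (d : nat) (P : 'M[R]_d) :
  is_stochastic P -> forall k x y, 0 <= (P ^+ k) x y.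
Proof.
move=> Pst; elim=> [|k IHk] x y; first by rewrite expr0 mxE ler0n.
rewrite exprS mxE; apply: sumr_ge0 => z _; apply: mulr_ge0 => //.
by have [/(_ z) + _] := Pst x; rewrite mxE.
Qed.

Lemma stationary_expr (R : realType) (d : nat) (P : 'M[R]_d) (pi : 'rV[R]_d) :
  is_stationary P pi -> forall k, pi *m P ^+ k = pi.
Proof.
move=> [_ piP]; elim=> [|k IHk]; first by rewrite expr0 mulmx1.
by rewrite exprS mulmxA piP.
Qed.

(** Some state has positive mass, and stationarity transports a positive part of
    it to every state that it reaches. *)
Lemma stationary_gt0 (R : realType) (d : nat) (P : 'M[R]_d) (pi : 'rV[R]_d) :
  is_stochastic P -> is_irreducible P -> is_stationary P pi ->
  forall y, 0 < pi 0 y.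
Proof.
move=> Pst Pirr Ppi y; have [[pi0 pi1] _] := Ppi.
have [x pix] : exists x, 0 < pi 0 x.
  apply/existsP; rewrite -[X in is_true X]negbK negb_exists.
  apply/negP => /forallP pin; move: (oner_neq0 R); rewrite -pi1 big1 ?eqxx //.
  by move=> x _; apply/eqP; rewrite eq_le pi0 andbT leNgt pin.
have [k Pk] := Pirr x y.
rewrite -(stationary_expr Ppi k) mxE (bigD1 x) //= ltr_wpDr ?mulr_gt0 //.
by apply: sumr_ge0 => z _; rewrite mulr_ge0 // stochastic_expr_ge0.
Qed.

Definition eigen_perturbation (R : realType) (d : nat) (P : 'M[R]_d)
    (pi : 'rV[R]_d) (a : R) (w : 'rV[R]_d) : Prop :=
  [/\ w != 0, w *m P = a *: w, \sum_x w 0 x = 0 &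
      forall x, `|w 0 x| <= pi 0 x / 2].

Lemma eigen_perturbation_exists (R : realType) (d : nat) (P : 'M[R]_d)
    (pi : 'rV[R]_d) (lam : d.-tuple R) (k : nat) :
  is_stochastic P -> is_irreducible P -> is_stationary P pi ->
  ordered_eigenvalues P lam -> (0 < k < d)%N ->
  exists w, eigen_perturbation P pi lam`_k w.
Proof.
move=> Pst Pirr Ppi [cP _ lam1] /andP[k0 kd].
have pi0 := stationary_gt0 Pst Pirr Ppi; have [[_ pi1] piP] := Ppi.
pose e : 'cV[R]_d := const_mx 1.
have mul_e m (A : 'M[R]_(m, d)) i j : (A *m e) i j = \sum_x A i x.
  by rewrite mxE; apply: eq_bigr => x _; rewrite mxE mulr1.
have Pe : P *m e = e.
  apply/matrixP => x y; rewrite mul_e mxE; have [_ <-] := Pst x.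
  by apply: eq_bigr => z _; rewrite mxE.
have pie : pi *m e = 1%:M.
  by apply/matrixP => x y; rewrite !ord1 mul_e pi1 mxE.
have lamE : tval lam = 1 :: behead lam.
  move: lam1 kd (size_tuple lam).
  by case: (tval lam) => [_ + d0|b s /= -> //]; rewrite -d0.
have alam : lam`_k \in behead lam.
  rewrite lamE; case: k k0 kd => // k _ kd /=.
  by rewrite mem_nth // size_behead size_tuple; case: (d) kd.
rewrite lamE in cP.
have [v [v0 vP ve]] := sum_zero_eigenvector Pe pie cP alam.
have v1 : \sum_x v 0 x = 0 by rewrite -(mul_e _ _ _ 0) ve mxE.
pose S := \sum_x `|v 0 x| / pi 0 x.
have leS x : `|v 0 x| / pi 0 x <= S.
  rewrite /S (bigD1 x) //= lerDl; apply: sumr_ge0 => y _.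
  by rewrite divr_ge0 // ltW.
have S0 : 0 < S.
  have [x vx] : exists x, v 0 x != 0 by apply/rV0Pn.
  by apply: lt_le_trans (leS x); rewrite divr_gt0 ?normr_gt0.
(* S dominates every relative size `|v x| / pi x, so this scaling brings them
   all below 1 / 2. *)
exists ((2 * S)^-1 *: v); split.
- by rewrite scaler_eq0 negb_or v0 andbT invr_eq0 mulf_neq0 ?gt_eqF.
- by rewrite -scalemxAl vP scalerA mulrC -scalerA.
- under eq_bigr => x _ do rewrite mxE.
  by rewrite -mulr_sumr v1 mulr0.
- move=> x; rewrite mxE normrM gtr0_norm ?invr_gt0 ?mulr_gt0 //.
  rewrite ler_pdivrMl ?mulr_gt0 //.
  by have := leS x; rewrite ler_pdivrMr //; lra.
Qed.

Section Perturbation.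
Variables (R : realType) (d : nat) (P : 'M[R]_d) (pi : 'rV[R]_d) (a : R)
  (w : 'rV[R]_d).
Hypotheses (Pst : is_stochastic P) (Pirr : is_irreducible P).
Hypotheses (Ppi : is_stationary P pi) (wP : eigen_perturbation P pi a w).

Lemma after_perturbation (t : nat) : after P t (pi + w) = pi + a ^+ t *: w.
Proof.
rewrite /after mulmxDl stationary_expr //; congr (_ + _).
have [_ wE _ _] := wP; elim: t => [|t IHt].
  by rewrite !expr0 mulmx1 scale1r.
by rewrite exprS mulmxA wE -scalemxAl IHt scalerA -exprS.
Qed.

(** [P ^+ t] is nonnegative and fixes [pi], so domination by [pi / 2]
    persists. *)
Lemma after_half_close (t : nat) :
  half_close (after P t (pi + w) 0) (pi 0).
Proof.
move=> x; have [_ _ _ wpi] := wP.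
rewrite /after mulmxDl stationary_expr // mxE addrAC subrr add0r.
rewrite -[in leRHS](stationary_expr Ppi t) !mxE mulr_suml.
apply: le_trans (ler_norm_sum _ _ _) _; apply: ler_sum => y _.
have Pk := stochastic_expr_ge0 Pst t y x.
by rewrite normrM (ger0_norm Pk) mulrAC ler_wpM2r.
Qed.

Lemma sum_after (t : nat) : \sum_x after P t (pi + w) 0 x = 1.
Proof.
have [_ _ w1 _] := wP; have [[_ pi1] _] := Ppi.
rewrite after_perturbation; under eq_bigr => x _ do rewrite !mxE.
by rewrite big_split /= -mulr_sumr w1 mulr0 addr0.
Qed.

Lemma chi2_after (t : nat) :
  chi2 (after P t (pi + w) 0) (pi 0) =
  a ^+ (2 * t) * chi2 ((pi + w) 0) (pi 0).
Proof.
rewrite after_perturbation /chi2 mulr_sumr; apply: eq_bigr => x _.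
by rewrite !mxE mulnC exprM; ring.
Qed.

Lemma chi2_perturbation_gt0 : 0 < chi2 ((pi + w) 0) (pi 0).
Proof.
have pi0 := stationary_gt0 Pst Pirr Ppi.
rewrite lt_def chi2_ge0 // andbT; have [w0 _ _ _] := wP.
have [x wx] : exists x, w 0 x != 0 by apply/rV0Pn.
rewrite psumr_neq0 => [|y _]; last by rewrite divr_ge0 ?sqr_ge0 // ltW.
apply/hasP; exists x; rewrite ?mem_index_enum //= mxE addrAC subrr add0r.
by rewrite divr_gt0 // lt_def sqrf_eq0 wx sqr_ge0.
Qed.

Lemma perturbation_testable (delta : R) (t : nat) : 0 < delta < 1 / 4 ->
  testable_at_rate delta P (pi + w) pi t
    (a ^+ (2 * t) * chi2 ((pi + w) 0) (pi 0)).
Proof.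
move=> dd; have pi0 := stationary_gt0 Pst Pirr Ppi.
have [[_ pi1] _] := Ppi; have [d0 _] := andP dd.
rewrite -chi2_after; split.
- by rewrite chi2_ge0 ?chi2_half_close //; exact: after_half_close.
- move=> n /(some_test_succeeds pi0 (sum_after t) pi1 (after_half_close t) d0).
  by move=> [psi ?]; exists psi; rewrite /max_error {2}/after stationary_expr.
- move=> n hn psi; rewrite /max_error {2}/after stationary_expr //.
  exact: (every_test_errs psi pi0 (sum_after t) pi1 dd hn).
Qed.

Lemma perturbation_admissible : admissible_pair (1 / 2) pi (pi + w) pi.
Proof.
have pi0 := stationary_gt0 Pst Pirr Ppi.
have [[pige0 pi1] _] := Ppi; have [w0 _ w1 wpi] := wP.
have close x : pi 0 x / 2 <= (pi + w) 0 x <= 3 / 2 * pi 0 x.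
  have := wpi x; rewrite mxE ler_norml => /andP[h1 h2].
  by apply/andP; split; lra.
have ratio : bounded_likelihood_ratio (1 / 2) (pi + w) pi.
  move=> x; have /andP[h1 h2] := close x.
  rewrite ler_pdivlMr // ler_pdivrMr //.
  by apply/andP; split; have := pi0 x; lra.
split=> //.
- split=> //; split=> [x|].
    by have /andP[h _] := close x; apply: le_trans h; rewrite divr_ge0.
  under eq_bigr => x _ do rewrite mxE.
  by rewrite big_split /= pi1 w1 addr0.
- by move/eqP; rewrite -subr_eq0 addrAC subrr add0r (negPf w0).
- move=> x; rewrite divff ?gt_eqF //; apply/andP; split; lra.
Qed.
End Perturbation.

(** * Comparing the two extreme eigenvectors *)

Unset Implicit Arguments.

(* c0, C0, K depend only on delta and eps (and K on the constants c, C used to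
   define the sample complexity); in particular not on d, P or t.
   Extended-real division has a / 0 = sg(a) * +oo and a / +oo = 0, and x ^+ 0 = 1
   for all x: if lam2 <> 0 = lamd and 1 <= t then the right-hand side is +oo,
   and so must be the left-hand side. *)
Theorem theorem8 (R : realType) (delta : R) (delta_bounds : 0 < delta < 1 / 4) :
  exists (c0 C0 : R -> R) (K : R -> R -> R -> R),
    [/\ forall eps : R, 0 < eps < 1 -> 0 < c0 eps /\ 0 < C0 eps,
        forall eps c C : R, 0 < eps < 1 -> 0 < c -> 0 < C -> 0 < K eps c C &
        forall (d : nat) (P : 'M[R]_d) (pi : 'rV[R]_d) (lam : d.-tuple R),
          (2 <= d)%N ->
          is_stochastic P -> is_irreducible P ->
          is_stationary P pi -> is_reversible P pi ->
          ordered_eigenvalues P lam ->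
          exists (eps : R) (mu mu' gam gam' : 'rV[R]_d),
            [/\ 0 < eps < 1,
                admissible_pair eps pi mu mu',
                admissible_pair eps pi gam gam',
                forall t : nat,
                  (exists N : \bar R, is_sample_complexity
                     delta (c0 eps) (C0 eps) P mu mu' t N) /\
                  (exists N : \bar R, is_sample_complexity
                     delta (c0 eps) (C0 eps) P gam gam' t N) &
                forall (c C : R), 0 < c -> 0 < C ->
                forall (t : nat) (Nmu0 Ngam0 Nmut Ngamt : \bar R),
                  is_sample_complexity delta c C P mu mu' 0 Nmu0 ->
                  is_sample_complexity delta c C P gam gam' 0 Ngam0 ->
                  is_sample_complexity delta c C P mu mu' t Nmut ->
                  is_sample_complexity delta c C P gam gam' t Ngamt ->
                  t = 0%N \/ lam`_1 <> 0 ->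
                  comparable_up_to (K eps c C)
                    (Nmut / Ngamt)%E
                    ((Nmu0 / Ngam0) *
                       (((lam`_1)%:E / (lam`_d.-1)%:E) ^+ (2 * t)%N))%E]].
Proof.
have [d0 _] := andP delta_bounds.
pose k1 (C : R) : R := 2 * delta ^+ 2 / (C + 1).
pose k2 (c : R) : R := 32 / (delta * c).
have k1p C : 0 < C -> 0 < k1 C.
  by move=> C0; rewrite divr_gt0 ?mulr_gt0 ?exprn_gt0 ?addr_gt0.
have k2p c : 0 < c -> 0 < k2 c by move=> c0; rewrite divr_gt0 ?mulr_gt0.
exists (fun=> 2 * delta ^+ 2), (fun=> 16 / delta),
  (fun _ c C => (k2 c / k1 C) ^+ 2); split.
- by move=> _ _; rewrite mulr_gt0 ?exprn_gt0 ?divr_gt0.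
- by move=> _ c C _ c0 C0; apply: exprn_gt0; apply: divr_gt0; auto.
move=> d P pi lam d2 Pst Pirr Ppi _ lamP.
have [w wP] : exists w, eigen_perturbation P pi lam`_d.-1 w.
  apply: (eigen_perturbation_exists Pst Pirr Ppi lamP).
  by rewrite ltn_predL -subn1 subn_gt0 d2 ltnW.
have [v vP] : exists v, eigen_perturbation P pi lam`_1 v.
  exact: (eigen_perturbation_exists Pst Pirr Ppi lamP).
exists (1 / 2), (pi + w), pi, (pi + v), pi; split.
- by apply/andP; split; lra.
- exact: perturbation_admissible wP.
- exact: perturbation_admissible vP.
- move=> t; split; eexists; apply: sample_complexity_exists => //.
    exact: (perturbation_testable Pst Pirr Ppi wP t delta_bounds).
  exact: (perturbation_testable Pst Pirr Ppi vP t delta_bounds).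
move=> c C c0 C0 t Nm0 Ng0 Nmt Ngt Hm0 Hg0 Hmt Hgt t_lam.
have order a u s N (uP : eigen_perturbation P pi a u)
    (HN : is_sample_complexity delta c C P (pi + u) pi s N) :=
  sample_complexity_has_order delta_bounds c0 C0
    (perturbation_testable Pst Pirr Ppi uP s delta_bounds) HN.
apply: (ratio_comparable (k1p C C0) (k2p c c0)
  (chi2_perturbation_gt0 Pst Pirr Ppi wP)
  (chi2_perturbation_gt0 Pst Pirr Ppi vP)) => //.
- by have := order _ _ _ _ wP Hm0; rewrite muln0 expr0 mul1r.
- by have := order _ _ _ _ vP Hg0; rewrite muln0 expr0 mul1r.
- exact: order wP Hmt.
- exact: order vP Hgt.
Qed.
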